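(* For every $r\in\{1,\infty\}$ and every $N\in\{0,2,3,\ldots\}$, the group $\mathbb{G}_r(N)$ is a Lévy group.
   Context: All groups are written additively. A value on a group $G$ is a function $p\colon G\to[0,\infty)$ with $p(x)=0\iff x=0$, $p(-x)=p(x)$, and $p(x+y)\le p(x)+p(y)$ for all $x,y\in G$. A value induces the metric $d_p(x,y)=p(x-y)$, and metric and topological notions for a valued group $(G,p)$ refer to $d_p$. Isometric group homomorphisms, embeddings and isomorphisms are group homomorphisms, embeddings and isomorphisms preserving the values. A valued Abelian group $(G,p)$ is of class $\mathcal{O}_0$ if $\lim_{n\to\infty}p(nx)/n=0$ for every $x\in G$. Let $\mathfrak{G}_\infty(0)$ be the class of all separable valued Abelian groups of class $\mathcal{O}_0$, and $\mathfrak{G}_1(0)$ the subclass of those $(G,p)$ with $p\le 1$. For $N\ge 2$, let $\mathfrak{G}_\infty(N)$ be the subclass of $\mathfrak{G}_\infty(0)$ of groups of exponent dividing $N$ (i.e. $Nx=0$ for all $x$), and $\mathfrak{G}_1(N)=\mathfrak{G}_\infty(N)\cap\mathfrak{G}_1(0)$. For $r\in\{1,\infty\}$ and $N\in\{0,2,3,\ldots\}$, $\mathbb{G}_r(N)$ denotes the valued Abelian group which is unique, up to isometric group isomorphism, with the following properties (its existence and uniqueness is a theorem of Niemiec): (1) $\mathbb{G}_r(N)$ is complete and belongs to $\mathfrak{G}_r(N)$; (2) every finite valued group in $\mathfrak{G}_r(N)$ admits an isometric group embedding into $\mathbb{G}_r(N)$; (3) every isometric group homomorphism between two finite subgroups of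 $\mathbb{G}_r(N)$ extends to an isometric group homomorphism of $\mathbb{G}_r(N)$ onto itself; (4) if $N=0$, the elements of finite order form a dense subgroup of $\mathbb{G}_r(N)$. A sequence $(X_i,d_i,\mu_i)$ of metric spaces with Borel probability measures is a Lévy sequence if every sequence of Borel sets $A_i\subseteq X_i$ with $\mu_i(A_i)\ge 1/2$ satisfies $\lim_{i\to\infty}\mu_i(B_{d_i}(A_i,\varepsilon))=1$ for every $\varepsilon>0$, where $B_{d}(A,\varepsilon)$ is the $\varepsilon$-neighbourhood of $A$ with respect to $d$. A Polish group $G$ with a compatible left-invariant metric $d$ is a Lévy group if it has an increasing sequence $(K_i)_{i\in\mathbb{N}}$ of compact subgroups such that $\bigcup_iK_i$ is dense in $G$ and $(K_i,d|_{K_i},\mu_i)$ is a Lévy sequence, where $\mu_i$ is the normalized Haar measure on $K_i$ (this does not depend on the choice of $d$). *)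

(* Defs.v *)
From HB Require Import structures.
From mathcomp Require Import all_boot all_order all_algebra.
From mathcomp Require Import all_classical all_reals all_analysis.

Set Implicit Arguments.
Unset Strict Implicit.
Unset Printing Implicit Defensive.

Import Order.TTheory GRing.Theory Num.Theory.
Import numFieldNormedType.Exports.

Local Open Scope classical_set_scope.
Local Open Scope ring_scope.

(* The library only equips pointed types with a sigma-algebra.  The choice of
   the point is irrelevant: a space carrying a probability is nonempty. *)
#[short(type="pmetricType")]
HB.structure Definition PointedMetric (R : numDomainType) :=
  { T of Pointed T & Metric R T }.

HB.mixin Record Zmodule_isValued (R : numDomainType) G & GRing.Zmodule G := {
  value : G -> R ;
  value_ge0 : forall x, 0 <= value x ;
  value_eq0P : forall x, value x = 0 <-> x = 0 ;
  valueN : forall x, value (- x) = value x ;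
  valueD : forall x y, value (x + y) <= value x + value y
}.

#[short(type="valuedZmodType")]
HB.structure Definition ValuedZmodule (R : numDomainType) :=
  { G of GRing.Zmodule G & Zmodule_isValued R G }.

(* Every valued group G is a metric space for d_p(x, y) = p(x - y).  The
   instances are attached to the projection ValuedZmodule.sort: on a concrete
   type they have to be copied, as for subgroup below.  (A structure extending
   both Zmodule and Metric cannot be declared, since the library's
   PseudoMetricNormedZmod structure would lack a join with it.) *)
Section value_metric.
Variables (R : numFieldType) (G : valuedZmodType R).

Definition value_dist (x y : G) : R := value (x - y).

Let distxx x : value_dist x x = 0.
Proof. by rewrite /value_dist subrr; apply/value_eq0P. Qed.

Let dist_positivity x y : value_dist x y = 0 -> x = y.
Proof. by move=> /value_eq0P /subr0_eq. Qed.

Let dist_sym x y : value_dist x y = value_dist y x.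
Proof. by rewrite /value_dist -valueN opprB. Qed.

Let dist_triangle y x z : value_dist x z <= value_dist x y + value_dist y z.
Proof. by rewrite /value_dist -(subrKA y); apply: valueD. Qed.

#[non_forgetful_inheritance]
HB.instance Definition _ :=
  isMetric.Build R G distxx dist_positivity dist_sym dist_triangle.

#[non_forgetful_inheritance]
HB.instance Definition _ := isPointed.Build G 0.

End value_metric.

(* A subgroup of G is given by a predicate K : zmodClosed G; here it is turned
   into a valued group (hence a metric space) by restriction. *)
Definition subgroup (G : zmodType) (K : zmodClosed G) : Type :=
  {x : G | x \in K}.

Section subgroup_zmodule.
Variables (G : zmodType) (K : zmodClosed G).

HB.instance Definition _ := [isSub of subgroup K for @sval G (fun x => x \in K)].
HB.instance Definition _ := [Choice of subgroup K by <:].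
HB.instance Definition _ := [SubChoice_isSubZmodule of subgroup K by <:].

End subgroup_zmodule.

Section subgroup_value.
Variables (R : numFieldType) (G : valuedZmodType R) (K : zmodClosed G).

Let val_value (x : subgroup K) : R := value (val x).

Let val_value_ge0 x : 0 <= val_value x. Proof. exact: value_ge0. Qed.

Let val_value_eq0P x : val_value x = 0 <-> x = 0.
Proof.
split=> [/value_eq0P x0|->]; first by apply: val_inj; rewrite x0 raddf0.
by apply/value_eq0P; rewrite raddf0.
Qed.

Let val_valueN x : val_value (- x) = val_value x.
Proof. by rewrite /val_value raddfN valueN. Qed.

Let val_valueD x y : val_value (x + y) <= val_value x + val_value y.
Proof. by rewrite /val_value raddfD valueD. Qed.

HB.instance Definition _ := Zmodule_isValued.Build R (subgroup K)
  val_value_ge0 val_value_eq0P val_valueN val_valueD.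

HB.instance Definition _ := PointedMetric.copy (subgroup K)
  (ValuedZmodule.sort (subgroup K : valuedZmodType R)).

End subgroup_value.

Definition separable (T : topologicalType) : Prop :=
  exists2 D : set T, countable D & dense D.

Definition complete (T : uniformType) : Prop :=
  forall F : set_system T, ProperFilter F -> cauchy F -> exists x : T, F --> x.

Definition completely_metrizable (R : realType) (T : topologicalType) : Prop :=
  exists (X : metricType R) (f : T -> X) (g : X -> T),
    [/\ complete X, cancel f g, cancel g f, continuous f & continuous g].

Definition polish (R : realType) (T : topologicalType) : Prop :=
  separable T /\ completely_metrizable R T.

Section niemiec_groups.
Variable R : realType.

Definition isometric (G H : valuedZmodType R) (f : G -> H) : Prop :=
  forall x, value (f x) = value x.

Definition class_O0 (G : valuedZmodType R) : Prop :=
  forall x : G, value (x *+ n) / n%:R @[n --> \oo] --> (0 : R).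

(* r is meant to be 1 or +oo; the bound by r is void when r = +oo. *)
Definition class_G (r : \bar R) (N : nat) (G : valuedZmodType R) : Prop :=
  [/\ separable G, class_O0 G,
      forall x : G, ((value x)%:E <= r)%E &
      (2 <= N)%N -> forall x : G, x *+ N = 0].

(* The properties (determining G up to isometric isomorphism) that define the
   group G_r(N). *)
Definition is_Niemiec_group (r : \bar R) (N : nat) (G : valuedZmodType R) :
    Prop :=
  [/\ complete G /\ class_G r N G,
      forall H : valuedZmodType R, finite_set [set: H] -> class_G r N H ->
        exists f : {additive H -> G}, isometric f,
      forall (A B : zmodClosed G) (f : {additive subgroup A -> subgroup B}),
        finite_set [set` A] -> finite_set [set` B] -> isometric f ->
        exists g : {additive G -> G},
          [/\ isometric g, forall y, exists x, g x = y &
              forall x : subgroup A, g (val x) = val (f x)] &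
      N = 0%N -> dense [set x : G | exists2 n, (0 < n)%N & x *+ n = 0]].

End niemiec_groups.

Section levy.
Variable R : realType.

Definition borel (X : pmetricType R) := g_sigma_algebraType (@open X).

Definition metric_nbhd (X : metricType R) (A : set X) (e : R) : set X :=
  [set x | exists2 a, A a & mdist a x < e].

Definition levy_sequence (X : nat -> pmetricType R)
    (mu : forall i, probability (borel (X i)) R) : Prop :=
  forall A : forall i, set (borel (X i)),
    (forall i, measurable (A i)) ->
    (forall i, ((2^-1)%:E <= mu i (A i))%E) ->
    forall e : R, 0 < e -> mu i (metric_nbhd (A i) e) @[i --> \oo] --> 1%E.

Definition is_haar (G : valuedZmodType R) (K : zmodClosed G)
    (mu : probability (borel (subgroup K)) R) : Prop :=
  forall (a : subgroup K) (B : set (borel (subgroup K))),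
    measurable B -> mu [set a + x | x in B] = mu B.

Definition topological_group (G : valuedZmodType R) : Prop :=
  continuous (fun xy : G * G => xy.1 + xy.2) /\ continuous (fun x : G => - x).

Definition left_invariant (G : valuedZmodType R) : Prop :=
  forall a x y : G, mdist (a + x) (a + y) = mdist x y.

(* An Abelian group with an invariant metric d is the same thing as a valued
   group, with p(x) = d(x, 0), so the notion is stated for valued groups and
   d = d_p. *)
Definition levy_group (G : valuedZmodType R) : Prop :=
  [/\ topological_group G, polish R G, left_invariant G &
      exists (K : nat -> zmodClosed G)
             (mu : forall i, probability (borel (subgroup (K i))) R),
        [/\ forall i, {subset K i <= K i.+1},
            forall i, compact [set` K i],
            dense (\bigcup_i [set` K i]),
            forall i, is_haar (mu i) &
            levy_sequence mu]].

End levy.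

(* Main.v *)
Require Import Defs.
From mathcomp Require Import all_boot all_order all_algebra.
From mathcomp Require Import all_classical all_reals all_analysis.
From HB Require Import structures.
From mathcomp Require Import ring lra.

(** Write p for the value.  The engine is the following doubling of a finite
    valued group L: on L x L put the value (p x + p y) / 2.  The diagonal embeds
    L isometrically into this group, and by the law of total variance the
    largest variance that a 1-Lipschitz function can have under the uniform
    distribution is at most half of that of L: freezing one coordinate, or
    averaging over it, leaves a 1/2-Lipschitz function, whose variance is a
    quarter of what is allowed on L, and there are two such contributions
    ([poincare_half_sum]).

    Let G be a Niemiec group and L a finite subgroup.  The doubled group is
    finite and again in the class, so it embeds into G; extending the diagonal
    map of L to a surjective isometry g of G and taking the preimage under g of
    the embedded copy gives a finite subgroup of G that contains L and is
    isometric to the double of L ([Niemiec_double]).  Iterating, every finite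
    subgroup lies in a finite subgroup with arbitrarily small variances, and one
    may adjoin any given element of finite order beforehand
    ([Niemiec_enlarge]).  The elements of finite order are dense, so a recursion
    along a dense sequence of them produces an increasing chain of finite
    subgroups K_i with dense union, on which 1-Lipschitz functions have variance
    at most 1 / (i + 1).

    Small variances force concentration ([concentration]): if A has measure at
    least 1/2, the distance f to A vanishes with probability at least 1/2, so
    half of the square of its mean is at most its variance v.  Hence f ^ 2 has
    mean at most 3 v, and the set where f >= e, the complement of the
    e-neighbourhood of A, has measure at most 3 v / e ^ 2. *)

Set Implicit Arguments.
Unset Strict Implicit.
Unset Printing Implicit Defensive.

Import Order.TTheory GRing.Theory Num.Theory.
Import numFieldNormedType.Exports.

Local Open Scope classical_set_scope.
Local Open Scope ring_scope.

(** * Mean and variance of a function along a finite sequence *)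

Section mean.
Context {R : realType}.

Definition mean (T : Type) (s : seq T) (f : T -> R) : R :=
  (\sum_(x <- s) f x) / (size s)%:R.

Definition variance (T : Type) (s : seq T) (f : T -> R) : R :=
  mean s (fun x => f x ^+ 2) - mean s f ^+ 2.

Lemma meanD (T : Type) (s : seq T) (f g : T -> R) :
  mean s (fun x => f x + g x) = mean s f + mean s g.
Proof. by rewrite /mean big_split mulrDl. Qed.

Lemma meanZ (T : Type) (s : seq T) (c : R) (f : T -> R) :
  mean s (fun x => c * f x) = c * mean s f.
Proof. by rewrite /mean -big_distrr mulrA. Qed.

Lemma meanB (T : Type) (s : seq T) (f g : T -> R) :
  mean s (fun x => f x - g x) = mean s f - mean s g.
Proof. by rewrite /mean sumrB mulrBl. Qed.

Lemma mean_cst (T : Type) (s : seq T) (c : R) :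
  (0 < size s)%N -> mean s (fun=> c) = c.
Proof.
move=> s0; rewrite /mean big_const_seq count_predT iter_addr_0.
by rewrite -[c *+ _]mulr_natr mulfK // pnatr_eq0 -lt0n.
Qed.

Lemma le_mean (T : Type) (s : seq T) (f g : T -> R) :
  (forall x, f x <= g x) -> mean s f <= mean s g.
Proof.
by move=> fg; rewrite ler_wpM2r ?invr_ge0 // ler_sum.
Qed.

Lemma ler_norm_mean (T : Type) (s : seq T) (f : T -> R) :
  `|mean s f| <= mean s (fun x => `|f x|).
Proof.
rewrite /mean normrM [X in _ * X <= _]ger0_norm ?invr_ge0 //.
by rewrite ler_wpM2r ?invr_ge0 // ler_norm_sum.
Qed.

Lemma mean_map (S T : Type) (h : S -> T) (s : seq S) (f : T -> R) :
  mean (map h s) f = mean s (f \o h).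
Proof. by rewrite /mean big_map size_map. Qed.

Lemma mean_allpairs (S T : Type) (s : seq S) (t : seq T) (f : S * T -> R) :
  mean [seq (x, y) | x <- s, y <- t] f =
  mean s (fun x => mean t (fun y => f (x, y))).
Proof.
rewrite /mean -big_distrl /= size_allpairs natrM invfM -mulrA [X in _ * X]mulrC.
by rewrite big_allpairs_dep.
Qed.

(** The law of total variance for the uniform distribution on a product. *)
Lemma variance_allpairs (S T : Type) (s : seq S) (t : seq T) (f : S * T -> R) :
  variance [seq (x, y) | x <- s, y <- t] f =
  mean s (fun x => variance t (fun y => f (x, y))) +
  variance s (fun x => mean t (fun y => f (x, y))).
Proof.
by rewrite /variance !mean_allpairs meanB addrA subrK.
Qed.

Lemma varianceZ (T : Type) (s : seq T) (c : R) (f : T -> R) :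
  variance s (fun x => c * f x) = c ^+ 2 * variance s f.
Proof.
rewrite /variance meanZ exprMn mulrBr -meanZ.
by congr (mean s _ - _); apply/funext => x; rewrite exprMn.
Qed.

(** The mean square deviation from c exceeds the variance by the squared bias,
    so it is minimal, equal to the variance, at the mean. *)
Lemma mean_sqrB (T : Type) (s : seq T) (c : R) (f : T -> R) :
  (0 < size s)%N ->
  mean s (fun x => (f x - c) ^+ 2) = variance s f + (mean s f - c) ^+ 2.
Proof.
move=> s0; pose g x := (f x ^+ 2 - 2 * c * f x) + c ^+ 2.
rewrite (_ : (fun x => (f x - c) ^+ 2) = g); last first.
  by apply/funext => x; rewrite /g; ring.
by rewrite /g meanD meanB meanZ mean_cst // /variance; ring.
Qed.

Lemma variance_map (S T : Type) (h : S -> T) (s : seq S) (f : T -> R) :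
  variance (map h s) f = variance s (f \o h).
Proof. by rewrite /variance !mean_map. Qed.

End mean.

(** * The doubling of a valued group *)

(** An alias of the product, which keeps the value defined below (a normalised
    l1 sum) apart from the topology that the library puts on pairs. *)
Definition half_sum (G : Type) : Type := (G * G)%type.

HB.instance Definition _ (G : zmodType) := GRing.Zmodule.on (half_sum G).

Section half_sum_value.
Variables (R : realType) (G : valuedZmodType R).

Let half_value (x : half_sum G) : R := (value x.1 + value x.2) / 2.

Let half_value_ge0 x : 0 <= half_value x.
Proof. by rewrite divr_ge0 // addr_ge0 ?value_ge0. Qed.

Let half_value_eq0P x : half_value x = 0 <-> x = 0.
Proof.
case: x => x y; rewrite /half_value /=; split=> [xy0|[-> ->]]; last first.
  by rewrite (value_eq0P _).2 // addr0 mul0r.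
have := value_ge0 x; have := value_ge0 y => y0 x0.
by congr (_, _); apply/value_eq0P; lra.
Qed.

Let half_valueN x : half_value (- x) = half_value x.
Proof. by rewrite /half_value /= !valueN. Qed.

Let half_valueD x y : half_value (x + y) <= half_value x + half_value y.
Proof.
rewrite /half_value /=.
by have := valueD x.1 y.1; have := valueD x.2 y.2; lra.
Qed.

HB.instance Definition _ := Zmodule_isValued.Build R (half_sum G)
  half_value_ge0 half_value_eq0P half_valueN half_valueD.

Lemma value_half_sum (x : half_sum G) : value x = (value x.1 + value x.2) / 2.
Proof. by []. Qed.

Lemma half_sum_mulrn (x : half_sum G) n : x *+ n = (x.1 *+ n, x.2 *+ n).
Proof. by elim: n => [|n IH]; [rewrite !mulr0n|rewrite !mulrS IH]. Qed.

End half_sum_value.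

(** * Variance bounds for Lipschitz functions on finite valued groups *)

Section poincare.
Variable R : realType.

Definition enumerates (T : eqType) (s : seq T) : Prop :=
  uniq s /\ forall x, x \in s.

Definition lipschitz1 (G : valuedZmodType R) (f : G -> R) : Prop :=
  forall x y, `|f x - f y| <= value (x - y).

(** A Poincare inequality for the uniform probability: the Lipschitz constant
    stands for the gradient.  Enumerability makes G finite. *)
Definition poincare (G : valuedZmodType R) (v : R) : Prop :=
  exists2 s : seq G, enumerates s & forall f, lipschitz1 f -> variance s f <= v.

Lemma size_enumerates (T : zmodType) (s : seq T) :
  enumerates s -> (0 < size s)%N.
Proof. by case=> _ /(_ 0); case: s. Qed.

(** A 1-Lipschitz f differs from the constant f 0 by at most the value, so its
    variance is at most the mean square of the value. *)
Lemma poincare_finite (G : valuedZmodType R) :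
  finite_set [set: G] -> exists v, poincare G v.
Proof.
move=> /finite_seqP[s0 s0E]; pose s := undup s0.
have sP : enumerates s.
  split=> [|x]; first exact: undup_uniq.
  by rewrite mem_undup; have : [set: G] x by []; rewrite s0E.
exists (mean s (fun x => value x ^+ 2)); exists s => // f f1.
have := mean_sqrB (f 0) f (size_enumerates sP).
suff : mean s (fun x => (f x - f 0) ^+ 2) <= mean s (fun x => value x ^+ 2).
  by have := sqr_ge0 (mean s f - f 0); lra.
apply: le_mean => x; rewrite -[leLHS]real_normK ?num_real //.
by rewrite ler_sqr ?nnegrE ?value_ge0 //; have := f1 x 0; rewrite subr0.
Qed.

(** Composition with k keeps functions 1-Lipschitz, and k carries the uniform
    distribution of G to that of H.  *)
Lemma poincare_isometry (G H : valuedZmodType R) (k : G -> H) (v : R) :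
  (forall x y, value (k x - k y) = value (x - y)) ->
  (forall y, exists x, k x = y) ->
  poincare G v -> poincare H v.
Proof.
move=> kiso ksurj [s [us sT] sv]; exists (map k s).
  split=> [|y].
    rewrite map_inj_uniq // => x y kxy.
    apply/eqP; rewrite -subr_eq0; apply/eqP/value_eq0P.
    by rewrite -kiso kxy subrr; apply/value_eq0P.
  by have [x <-] := ksurj y; rewrite map_f.
move=> f f1; rewrite variance_map; apply: sv => x y /=.
by rewrite -kiso f1.
Qed.

(** Variance is quadratic, so halving the Lipschitz constant divides the bound
    by 4. *)
Lemma lipschitz_half_variance (G : valuedZmodType R) (s : seq G) (v : R)
    (f : G -> R) :
  (forall g, lipschitz1 g -> variance s g <= v) ->
  (forall x y, `|f x - f y| <= value (x - y) / 2) -> variance s f <= v / 4.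
Proof.
move=> sv f1; have : variance s (fun x => 2 * f x) <= v.
  by apply: sv => x y; rewrite -mulrBr normrM ger0_norm //; have := f1 x y; lra.
by rewrite varianceZ; lra.
Qed.

(** Both terms of the law of total variance concern 1/2-Lipschitz functions of
    one coordinate, so each contributes at most v / 4. *)
Lemma poincare_half_sum (G : valuedZmodType R) (v : R) :
  poincare G v -> poincare (half_sum G) (v / 2).
Proof.
move=> [s [us sT] sv]; exists [seq (x, y) | x <- s, y <- s].
  split=> [|[x y]]; last by rewrite allpairs_f.
  by apply: allpairs_uniq => // -[? ?] [? ?] _ _.
have s0 : (0 < size s)%N by exact: size_enumerates.
move=> f f1; rewrite variance_allpairs.
have f1l x x' y : `|f (x, y) - f (x', y)| <= value (x - x') / 2.
  apply: le_trans (f1 _ _) _; rewrite value_half_sum /= subrr.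
  by rewrite (value_eq0P 0).2 // addr0.
have f1r x y y' : `|f (x, y) - f (x, y')| <= value (y - y') / 2.
  apply: le_trans (f1 _ _) _; rewrite value_half_sum /= subrr.
  by rewrite (value_eq0P 0).2 // add0r.
rewrite (_ : v / 2 = v / 4 + v / 4); last by field.
apply: lerD.
  rewrite -(mean_cst (v / 4) s0); apply: le_mean => x.
  exact: lipschitz_half_variance.
apply: lipschitz_half_variance => // x x'; rewrite -meanB.
apply: le_trans (ler_norm_mean _ _) _.
by rewrite -(mean_cst (value (x - x') / 2) s0); apply: le_mean => y.
Qed.

End poincare.

(** * Finite subgroups and their doubles *)

Section subgroups.
Variable R : realType.

Lemma zmodClosed_of_set (G : zmodType) (A : set G) :
  A 0 -> (forall x y, A x -> A y -> A (x - y)) ->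
  exists K : zmodClosed G, [set` K] = A.
Proof.
move=> A0 AB; pose K : {pred G} := fun x => x \in A.
have cK : zmod_closed K.
  by split=> [|x y]; rewrite !inE; [exact: A0|exact: AB].
pose mK := GRing.isZmodClosed.Build G K cK.
pose K' : zmodClosed G := HB.pack K mK.
by exists K'; apply/seteqP; split=> x; rewrite /= unfold_in /= inE.
Qed.

Lemma finite_subgroup (G : zmodType) (K : zmodClosed G) :
  finite_set [set` K] -> finite_set [set: subgroup K].
Proof.
move=> finK; have -> : [set: subgroup K] = val @^-1` [set` K].
  by apply/seteqP; split=> // x _; exact: (valP x).
by apply: finite_preimage finK => x y _ _; exact: val_inj.
Qed.

Lemma finite_separable (G : valuedZmodType R) :
  finite_set [set: G] -> separable G.
Proof.
move=> finG; exists setT; first exact: finite_set_countable.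
by move=> O [x Ox] _; exists x.
Qed.

(** The values are bounded, so dividing by n makes them vanish in the limit. *)
Lemma finite_class_O0 (G : valuedZmodType R) :
  finite_set [set: G] -> class_O0 G.
Proof.
move=> /finite_seqP[s sE] x.
pose M : R := \sum_(y <- s) value y.
have valM (y : G) : value y <= M.
  have ys : y \in s by have : [set: G] y by []; rewrite sE.
  by rewrite /M (big_rem y) //= lerDl sumr_ge0 // => z _; exact: value_ge0.
apply: (@squeeze_cvgr _ _ _ _ (fun=> 0) (fun n => M / n%:R)).
- near=> n; rewrite divr_ge0 ?value_ge0 //=.
  by rewrite ler_wpM2r ?invr_ge0.
- exact: cvg_cst.
- rewrite -[X in _ --> X](mulr0 M); apply: cvgM; first exact: cvg_cst.
  by rewrite -cvg_shiftS; exact: cvg_harmonic.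
Unshelve. all: by end_near.
Qed.

Lemma finite_half_sum (G : zmodType) (L : zmodClosed G) :
  finite_set [set` L] -> finite_set [set: half_sum (subgroup L)].
Proof.
move=> /finite_subgroup finL.
have -> : [set: half_sum (subgroup L)] = [set: subgroup L] `*` [set: subgroup L].
  by apply/seteqP.
exact: finite_setX.
Qed.

(** This closure property is what makes the double of a finite subgroup
    embeddable in a Niemiec group. *)
Lemma class_G_half_sum (r : \bar R) (N : nat) (G : valuedZmodType R)
    (L : zmodClosed G) :
  finite_set [set` L] -> class_G r N G -> class_G r N (half_sum (subgroup L)).
Proof.
move=> finL [_ _ Gr GN].
have finH := finite_half_sum finL.
split; [exact: finite_separable|exact: finite_class_O0| |].
  move=> [x y]; rewrite value_half_sum /=.
  have := Gr (val x); have := Gr (val y); case: r {Gr} => [r| |//].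
    rewrite !lee_fin => yr xr.
    change (value x) with (value (val x)); change (value y) with (value (val y)).
    lra.
  by move=> _ _; exact: leey.
move=> /GN GN0 [x y]; rewrite half_sum_mulrn /=.
by congr (_, _); apply: val_inj; rewrite raddfMn /= GN0.
Qed.

End subgroups.

(** * Enlarging finite subgroups of a Niemiec group *)

Section enlarging.
Variable R : realType.

Lemma adjoin_torsion (G : zmodType) (K : zmodClosed G) (t : G) (m : nat) :
  finite_set [set` K] -> (0 < m)%N -> t *+ m = 0 ->
  exists L : zmodClosed G,
    [/\ finite_set [set` L], {subset K <= L} & t \in L].
Proof.
move=> finK m0 tm.
pose A := [set x + t *+ j | x in [set` K] & j in [set: nat]].
(* As t has order dividing m, the multiples t *+ j with j in nat already
   contain their opposites. *)
have negt j : - (t *+ j) = t *+ (j * m.-1).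
  apply/eqP; rewrite eq_sym -addr_eq0 -mulrnDr -mulnSr prednK //.
  by rewrite mulnC mulrnA tm mul0rn.
have [L LA] : exists L : zmodClosed G, [set` L] = A.
  apply: zmodClosed_of_set.
    by exists 0; [exact: rpred0|exists 0%N => //; rewrite addr0].
  move=> _ _ [x xK [i _ <-]] [y yK [j _ <-]].
  exists (x - y); first exact: rpredB.
  by exists (i + j * m.-1)%N => //; rewrite mulrnDr -negt opprD addrACA.
have LP x : (x \in L) = (x \in A) by apply/idP/idP; rewrite inE -LA.
exists L; split.
- rewrite LA.
  have -> : A = [set x + t *+ j | x in [set` K] & j in `I_m].
    apply/seteqP; split=> _ [x xK [j jm <-]]; exists x => //; last by exists j.
    exists (j %% m)%N; first by rewrite /= ltn_mod.
    by rewrite {2}(divn_eq j m) mulrnDr mulnC mulrnA tm mul0rn add0r.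
  by apply: finite_image2 => //; exact: finite_II.
- move=> x xK; rewrite LP inE.
  by exists x => //; exists 0%N => //; rewrite addr0.
- rewrite LP inE.
  by exists 0; [exact: rpred0|exists 1%N => //; rewrite add0r].
Qed.

(** With f the embedding of the double of L and g an isometry of G that sends
    each x in L to f (x, x), the subgroup L' is the preimage by g of the range
    of f: it contains L because g maps L into that range. *)
Lemma Niemiec_double (r : \bar R) (N : nat) (G : valuedZmodType R)
    (L : zmodClosed G) (v : R) :
  is_Niemiec_group r N G -> finite_set [set` L] -> poincare (subgroup L) v ->
  exists L' : zmodClosed G,
    [/\ finite_set [set` L'], {subset L <= L'} &
        poincare (subgroup L') (v / 2)].
Proof.
move=> [[_ GG] embed extend _] finL Lv.
have finLL : finite_set [set: half_sum (subgroup L)].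
  exact: finite_half_sum.
have [f fiso] := embed _ finLL (class_G_half_sum finL GG).
have [B BE] : exists B : zmodClosed G, [set` B] = range f.
  apply: zmodClosed_of_set; first by exists 0; rewrite ?raddf0.
  by move=> _ _ [x _ <-] [y _ <-]; exists (x - y); rewrite ?raddfB.
have fB x : f x \in B.
  by have : range f (f x) by [exists x]; rewrite -BE.
pose diag (x : subgroup L) : subgroup B := Sub (f (x, x)) (fB (x, x)).
have diagB : zmod_morphism diag.
  by move=> x y; apply: val_inj; rewrite /= -raddfB.
pose diagA : {additive subgroup L -> subgroup B} :=
  HB.pack diag (GRing.isZmodMorphism.Build _ _ diag diagB).
have diag_iso : isometric diagA.
  move=> x; rewrite -[LHS]/(value (f (x, x))) fiso value_half_sum /=.
  by field.
have finB : finite_set [set` B] by rewrite BE; exact: finite_image.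
have [g [giso gsurj gdiag]] := extend L B diagA finL finB diag_iso.
have ginj : injective g.
  move=> x y gxy; apply/eqP; rewrite -subr_eq0; apply/eqP/value_eq0P.
  by rewrite -giso raddfB gxy subrr; apply/value_eq0P.
have [h gK] := choice gsurj.
have [L' L'E] : exists L' : zmodClosed G, [set` L'] = g @^-1` [set` B].
  apply: zmodClosed_of_set; first by rewrite /= raddf0 rpred0.
  by move=> x y; rewrite /= raddfB; exact: rpredB.
have L'P x : (x \in L') = (g x \in B).
  by apply/idP/idP => xL; [have : [set` L'] x|have : (g @^-1` [set` B]) x] => //;
     [rewrite L'E|rewrite -L'E].
exists L'; split.
- rewrite L'E; apply: finite_preimage finB => x y _ _; exact: ginj.
- move=> x xL; rewrite L'P.
  by rewrite -[x]/(val (Sub x xL : subgroup L)) gdiag; exact: valP.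
(* The inverse h of g turns f into an isometry from the double onto L'. *)
- have hL' x : h (f x) \in L' by rewrite L'P gK.
  pose k (x : half_sum (subgroup L)) : subgroup L' := Sub (h (f x)) (hL' x).
  apply: (poincare_isometry (k := k)) (poincare_half_sum Lv) => [x y|y].
    rewrite -[LHS]/(value (h (f x) - h (f y))).
    by rewrite -giso raddfB !gK -raddfB fiso.
  have : [set` B] (g (val y)) by rewrite /= -L'P; exact: valP.
  rewrite BE => -[x _ fx]; exists x; apply: val_inj => /=.
  by apply: ginj; rewrite gK fx.
Qed.

Lemma Niemiec_enlarge (r : \bar R) (N : nat) (G : valuedZmodType R)
    (K : zmodClosed G) (t : G) (m : nat) (e : R) :
  is_Niemiec_group r N G -> finite_set [set` K] ->
  (0 < m)%N -> t *+ m = 0 -> 0 < e ->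
  exists L : zmodClosed G,
    [/\ finite_set [set` L], {subset K <= L}, t \in L &
        poincare (subgroup L) e].
Proof.
move=> GN finK m0 tm e0.
have [L0 [finL0 KL0 tL0]] := adjoin_torsion finK m0 tm.
have [v L0v] := poincare_finite (finite_subgroup finL0).
have double n : exists L : zmodClosed G,
    [/\ finite_set [set` L], {subset L0 <= L} &
        poincare (subgroup L) (v / 2 ^+ n)].
  elim: n => [|n [L [finL L0L Lv]]].
    by exists L0; rewrite divr1; split.
  have [L' [finL' LL' L'v]] := Niemiec_double GN finL Lv.
  exists L'; split=> //; first by move=> x /L0L /LL'.
  by rewrite exprSr invfM mulrA.
have [n vn] : exists n, v / 2 ^+ n <= e.
  exists (Num.bound (`|v| / e)); rewrite ler_pdivrMr ?exprn_gt0 // mulrC.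
  rewrite -ler_pdivrMr // (le_trans (ler_wpM2r _ (ler_norm v))) ?invr_ge0 ?ltW //.
  apply: lt_trans (archi_boundP _) _; first by rewrite divr_ge0 // ltW.
  by rewrite -natrX ltr_nat ltn_expl.
have [L [finL L0L [s sL sv]]] := double n.
exists L; split=> //; [by move=> x /KL0 /L0L|exact: L0L|].
by exists s => // f /sv; move/le_trans; apply.
Qed.

End enlarging.

(** * The uniform probability of a finite valued group *)

Section uniform.
Variables (R : realType) (G : valuedZmodType R) (s : seq G).
Hypothesis sG : enumerates s.

Lemma enumerates_measurable (A : set (borel G)) : measurable A.
Proof.
have finA : finite_set (~` A : set G).
  apply: (sub_finite_set (B := [set` s])) => [x _|]; last exact: finite_seq.
  exact: sG.2.
apply: sub_sigma_algebra; rewrite -[A]setCK openC.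
apply: ((@accessible_finite_set_closed G).1 _ _ finA).
by apply: hausdorff_accessible; exact: metric_hausdorff.
Qed.

(** The normalised sum of the Dirac masses at the entries of s. *)
Lemma uniform_probability : exists mu : probability (borel G) R,
  forall A : set (borel G), mu A = (mean s (\1_(A : set G)))%:E.
Proof.
have n_ge0 : 0 <= (size s)%:R^-1 :> R by rewrite invr_ge0.
pose m : {measure set (borel G) -> \bar R} :=
  mscale (NngNum n_ge0)
    (msum (fun i => dirac (nth 0 s i : borel G)) (size s)).
have mE A : m A = (mean s (\1_(A : set G)))%:E.
  rewrite /m /= /mscale /= /msum /mean mulrC EFinM; congr *%E.
  by rewrite (big_nth 0) big_mkord -sumEFin; apply: eq_bigr.
have m1 : m setT = 1%E.
  by rewrite mE indicT (mean_cst 1 (size_enumerates sG)).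
pose mu : probability (borel G) R :=
  HB.pack (Measure.sort m) (Measure_isProbability.Build _ _ _ m m1).
by exists mu => A; rewrite -mE.
Qed.

End uniform.

(** * Concentration of measure *)

Section concentration.
Variable R : realType.

Lemma mean_shift (T : zmodType) (s : seq T) (a : T) (f : T -> R) :
  enumerates s -> mean s (fun x => f (a + x)) = mean s f.
Proof.
move=> [us sT]; have : perm_eq (map (+%R a) s) s.
  apply: uniq_perm => // [|x]; first by rewrite map_inj_uniq //; exact: addrI.
  by rewrite sT -(subrKC a x) map_f.
by move=> sp; rewrite -[RHS]/(_ / _) -(perm_big _ sp) big_map.
Qed.

Definition dist_to (G : valuedZmodType R) (A : set G) (x : G) : R :=
  inf [set value (a - x) | a in A].

Lemma dist_to_le (G : valuedZmodType R) (A : set G) (a x : G) :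
  A a -> dist_to A x <= value (a - x).
Proof.
move=> Aa; apply: ge_inf; last by exists a.
by exists 0 => _ [b _ <-]; exact: value_ge0.
Qed.

Lemma le_dist_to (G : valuedZmodType R) (A : set G) (x : G) (c : R) :
  A !=set0 -> (forall a, A a -> c <= value (a - x)) -> c <= dist_to A x.
Proof.
move=> [a Aa] cA; apply: lb_le_inf; first by exists (value (a - x)), a.
by move=> _ [b Ab <-]; exact: cA.
Qed.

(** The triangle inequality through an arbitrary point of A; nonemptiness
    matters because the infimum of the empty set is the default value 0. *)
Lemma lipschitz1_dist_to (G : valuedZmodType R) (A : set G) :
  A !=set0 -> lipschitz1 (dist_to A).
Proof.
move=> A0; have half x y : dist_to A x - value (x - y) <= dist_to A y.
  apply: le_dist_to => // a Aa; rewrite lerBlDr.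
  apply: le_trans (dist_to_le x Aa) _.
  by have := valueD (a - y) (y - x); rewrite addrA subrK -[y - x]opprB valueN.
move=> x y; rewrite ler_distl; have := half x y; have := half y x.
by rewrite -[y - x]opprB valueN => ? ?; apply/andP; split; lra.
Qed.

(** Chebyshev's inequality for the distance to A, whose mean is controlled by
    its variance since it vanishes on half of the space. *)
Lemma concentration (G : valuedZmodType R) (s : seq G) (v e : R) (A : set G) :
  enumerates s -> (forall f, lipschitz1 f -> variance s f <= v) ->
  2^-1 <= mean s \1_A :> R -> 0 < e ->
  1 - 3 * v / e ^+ 2 <= mean s \1_(metric_nbhd A e).
Proof.
move=> sG sv A2 e0; have s0 := size_enumerates sG.
have A0 : A !=set0.
  apply/set0P/eqP => A0; move: A2; rewrite A0 indic0.
  by rewrite (mean_cst 0 s0) leNgt invr_gt0 ltr0n.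
pose f := dist_to A; pose m := mean s f.
have f1 : lipschitz1 f by exact: lipschitz1_dist_to.
have varf := sv f f1.
have f_ge0 x : 0 <= f x by apply: le_dist_to => // a _; exact: value_ge0.
have fA x : A x -> f x = 0.
  move=> Ax; apply/le_anti; rewrite f_ge0 andbT.
  by have := dist_to_le x Ax; rewrite subrr (value_eq0P 0).2.
(* On A the deviation of f from its mean m is m itself. *)
have m2 : m ^+ 2 <= 2 * v.
  have : m ^+ 2 * mean s \1_A <= v.
    rewrite -meanZ; apply: le_trans varf.
    rewrite -[leRHS]addr0 -[X in _ + X](expr0n _ 2) -(subrr m) -mean_sqrB //.
    apply: le_mean => x; rewrite indicE.
    case: (boolP (x \in A)) => [/set_mem Ax|_].
      by rewrite mulr1 (fA _ Ax) sub0r sqrrN.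
    by rewrite mulr0 sqr_ge0.
  by have := ler_wpM2l (sqr_ge0 m) A2; lra.
have f2 : mean s (fun x => f x ^+ 2) <= 3 * v.
  by rewrite /variance -/m in varf; lra.
have eB : e ^+ 2 * mean s (fun x => 1 - \1_(metric_nbhd A e) x) <= 3 * v.
  apply: le_trans f2; rewrite -meanZ; apply: le_mean => x; rewrite indicE.
  case: (boolP (x \in _)) => [_|/negP xA]; first by rewrite subrr mulr0 sqr_ge0.
  rewrite subr0 mulr1 ler_sqr ?nnegrE ?(ltW e0) ?f_ge0 //.
  apply: le_dist_to => // a Aa; rewrite leNgt; apply/negP => ax.
  by apply: xA; apply/mem_set; exists a.
rewrite meanB (mean_cst 1 s0) in eB.
rewrite lerBlDr -lerBlDl ler_pdivlMr ?exprn_gt0 //.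
by rewrite mulrC.
Qed.

End concentration.

(** * Lévy groups *)

Section levy_groups.
Variable R : realType.

Lemma value_topological_group (G : valuedZmodType R) : topological_group G.
Proof.
split=> [[x y]|x].
  apply/cvg_ballP => e e0.
  exists (ball x (e / 2), ball y (e / 2)).
    by split; apply: nbhsx_ballx; rewrite divr_gt0.
  move=> [x' y'] /= []; rewrite !ballEmdist /=.
  rewrite -[mdist x x']/(value (x - x')) -[mdist y y']/(value (y - y')).
  rewrite -[mdist _ _]/(value (x + y - (x' + y'))) => xx' yy'.
  by have := valueD (x - x') (y - y'); rewrite addrACA -opprD; lra.
apply/(@cvg_ballP _ G _ _ (nbhs_filter x)) => e e0.
near=> x'; rewrite ballEmdist /= -[mdist _ _]/(value (- x - - x')).
rewrite -opprD valueN.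
have : ball x e x' by near: x'; exact: nbhsx_ballx.
by rewrite ballEmdist.
Unshelve. all: by end_near.
Qed.

Lemma value_left_invariant (G : valuedZmodType R) : left_invariant G.
Proof.
move=> a x y; rewrite -[LHS]/(value (a + x - (a + y))).
by rewrite opprD addrACA subrr add0r.
Qed.

Lemma complete_separable_polish (G : valuedZmodType R) :
  complete G -> separable G -> polish R G.
Proof.
by move=> cG sG; split=> //; exists G, id, id; split=> // x; exact: cvg_id.
Qed.

(** Translations permute any enumeration, so the uniform probability is the
    Haar measure; the bound is that of [concentration]. *)
Lemma poincare_haar (G : valuedZmodType R) (K : zmodClosed G) (v : R) :
  poincare (subgroup K) v ->
  exists mu : probability (borel (subgroup K)) R, is_haar mu /\
    forall (A : set (borel (subgroup K))) (e : R), 0 < e ->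
      ((2^-1)%:E <= mu A)%E ->
      ((1 - 3 * v / e ^+ 2)%:E <= mu (metric_nbhd A e))%E.
Proof.
move=> [s sK sv]; have [mu muE] := uniform_probability sK.
exists mu; split=> [a B _|A e e0]; rewrite !muE.
  rewrite -[in LHS](mean_shift a _ sK); congr (mean s _)%:E.
  apply/funext => x; rewrite !indicE; congr (_%:R); congr nat_of_bool.
  apply/idP/idP => /set_mem xB; apply/mem_set; last by exists x.
  by case: xB => y yB /addrI <-.
by rewrite !lee_fin => A2; exact: concentration.
Qed.

Lemma countable_range (T : pointedType) (D : set T) :
  countable D -> exists d : nat -> T, D `<=` range d.
Proof.
move=> /countable_injP[f finj].
exists (fun n => xget point [set x | D x /\ f x = n]) => x Dx.
exists (f x) => //; case: xgetP => [y _ [Dy fyx]|/(_ x)]; last by case.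
by apply: finj => //; exact/mem_set.
Qed.

End levy_groups.

Theorem theorem4p2 (R : realType) (r : \bar R) (N : nat)
    (G : valuedZmodType R) :
  (r = 1%E \/ r = +oo%E) -> (N = 0%N \/ (2 <= N)%N) ->
  is_Niemiec_group r N G -> levy_group G.
Proof.
move=> _ N02 GN; have [[cG [sepG _ _ GtorsN]] _ _ dense_tors] := GN.
split.
- exact: value_topological_group.
- exact: complete_separable_polish.
- exact: value_left_invariant.
have tors (x : G) (e : R) : 0 < e ->
    exists t, exists2 m, value (x - t) < e & (0 < m)%N /\ t *+ m = 0.
  move=> e0; case: N02 => [N0|N2]; last first.
    exists x, N; first by rewrite subrr (value_eq0P 0).2.
    by split; [exact: leq_trans N2|exact: GtorsN].
  have xB : (ball x e)° !=set0 by exists x; exact: nbhsx_ballx.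
  have [t [xt [m m0 tm]]] := dense_tors N0 _ xB (open_interior _).
  exists t, m => //.
  have {}xt : ball x e t := interior_subset xt.
  by rewrite ballEmdist in xt.
have [D cD denseD] := sepG.
have [d Dd] := countable_range cD.
(* The pair (k, n) asks for a torsion element close to the k-th point of a
   dense sequence, with precision 1 / (n + 1). *)
have tors_near (p : nat * nat) : exists t, exists2 m,
    value (d p.1 - t) < p.2.+1%:R^-1 & (0 < m)%N /\ t *+ m = 0.
  by apply: tors; rewrite invr_gt0.
have [t tP] := choice tors_near.
pose fin_subgroup := {K : zmodClosed G | finite_set [set` K]}.
have step (iK : nat * fin_subgroup) : exists L : fin_subgroup,
    [/\ {subset sval iK.2 <= sval L},
        (if unpickle iK.1 is Some p then t p \in sval L else true) &
        poincare (subgroup (sval L)) (iK.1.+1%:R^-1 : R)].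
  case: iK => i [K finK] /=.
  pose p := odflt (0, 0)%N (unpickle i).
  have [m _ [m0 tm]] := tP p.
  have i0 : 0 < (i.+1%:R^-1 : R) by rewrite invr_gt0.
  have [L [finL KL tL Lv]] := Niemiec_enlarge GN finK m0 tm i0.
  exists (exist _ L finL); split=> //=.
  by move: tL; rewrite /p; case: unpickle.
have [F FP] := choice step.
have [K0 K0E] : exists K : zmodClosed G, [set` K] = [set 0].
  by apply: zmodClosed_of_set => // _ _ -> ->; rewrite subr0.
have finK0 : finite_set [set` K0] by rewrite K0E; exact: finite_set1.
pose X := nat_rect (fun=> fin_subgroup) (exist _ K0 finK0) (fun i K => F (i, K)).
(* X 0 is trivial and satisfies no prescribed bound, hence the shift by one. *)
pose K i := sval (X i.+1).
have KP i : poincare (subgroup (K i)) (i.+1%:R^-1 : R).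
  by have [] := FP (i, X i).
pose mu i := sval (cid (poincare_haar (KP i))).
exists K, mu; split.
- by move=> i; have [] := FP (i.+1, X i.+1).
- by move=> i; apply: finite_compact; exact: (svalP (X i.+1)).
- move=> O O0 oO; have [x [Ox Dx]] := denseD O O0 oO.
  have [_ /posnumP[e] eO] := (nbhs_ballP _ _).1 (open_nbhs_nbhs (conj oO Ox)).
  have [n ne] : exists n, (n.+1%:R^-1 : R) < e%:num.
    by have [n _ nP] := near_infty_natSinv_lt e; exists n; apply: nP => /=.
  have [k _ dk] := Dd x Dx.
  exists (t (k, n)); split.
    apply: eO; rewrite ballEmdist /=; apply: lt_trans ne.
    by have [m] := tP (k, n); rewrite /= dk.
  exists (pickle (k, n)) => //=.
  by have [_ + _] := FP (pickle (k, n), X (pickle (k, n))); rewrite /= pickleK.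
- by move=> i; have [] := svalP (cid (poincare_haar (KP i))).
move=> A mA A2 e e0.
apply: (@squeeze_cvge _ _ _ _
  (fun i => (1 - 3 / e ^+ 2 * (i.+1%:R^-1 : R))%:E) _ (fun=> 1%E)).
- near=> i; apply/andP; split; last first.
    apply: probability_le1.
    by have [s sK _] := KP i; exact: (enumerates_measurable sK).
  have [_ /(_ (A i) e e0 (A2 i))] := svalP (cid (poincare_haar (KP i))).
  by rewrite mulrAC.
- apply: cvg_EFin; first by near=> i.
  rewrite -[X in _ --> X]subr0 -[X in _ - X](mulr0 (3 / e ^+ 2)).
  apply: cvgB; first exact: cvg_cst.
  by apply: cvgM; [exact: cvg_cst|exact: cvg_harmonic].
- exact: cvg_cst.
Unshelve. all: by end_near.
Qed.
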